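(* Let $a, b \in \mathbb{R}$, $m \in \mathbb{N}$ and $k, p \in \mathbb{R}^{+}$. Define $$\mathcal{G}(k,m,a,b,p) = \int_0^\infty x^{k-1} Q_m(a, b\sqrt{x})\, e^{-px}\,{\rm d}x .$$ Then $$\mathcal{G}(k,m,a,b,p) = \frac{\Gamma(k)}{p^k} - \left(\frac{2}{b^2+2p}\right)^{k} e^{-\frac{a^2}{2}}\,\Gamma(k)\left[\Phi_1\!\left(k,1,1;\frac{b^2}{b^2+2p},\frac{a^2b^2}{2b^2+4p}\right) - \sum_{n=0}^{m-1}\frac{(k)_n}{n!}\left(\frac{b^2}{b^2+2p}\right)^{n} {}_1F_1\!\left(k+n;n+1;\frac{a^2b^2}{2b^2+4p}\right)\right].$$
   Context: $Q_m(\alpha,\beta)$ is the generalized Marcum $Q$-function, $Q_m(\alpha,\beta) = \alpha^{1-m}\int_\beta^\infty t^{m} e^{-(t^2+\alpha^2)/2} I_{m-1}(\alpha t)\,{\rm d}t$ (with the limiting value for $\alpha=0$), where $I_{\nu}$ is the modified Bessel function of the first kind. $\Gamma$ is the Euler Gamma function, $(x)_n=\Gamma(x+n)/\Gamma(x)$ is the Pochhammer symbol, ${}_1F_1(\alpha;\gamma;z)=\sum_{l\ge 0}\frac{(\alpha)_l}{(\gamma)_l}\frac{z^l}{l!}$ is the Kummer confluent hypergeometric function, and $\Phi_1$ is the Humbert hypergeometric function of the first kind, $\Phi_1(\alpha,\beta,\gamma;x,y)=\sum_{n\ge0}\sum_{l\ge0}\frac{(\alpha)_{n+l}(\beta)_n}{(\gamma)_{n+l}}\frac{x^n}{n!}\frac{y^l}{l!}$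 for $|x|<1$. *)

(* Defs.v *)
From Stdlib Require Import Reals Factorial.
From Coquelicot Require Import Coquelicot.
Open Scope R_scope.

Definition Gamma (k : R) : R :=
  RInt_gen (fun t => Rpower t (k - 1) * exp (- t))
           (at_right 0) (Rbar_locally p_infty).

Definition poch (x : R) (n : nat) : R := Gamma (x + INR n) / Gamma x.

Definition besselI (n : nat) (z : R) : R :=
  Series (fun l => (z / 2) ^ (2 * l + n) / (INR (Factorial.fact l) * INR (Factorial.fact (l + n)))).

(* Generalized Marcum Q-function, m >= 1:
   Q_m(al,be) = al^(1-m) int_be^oo t^m e^{-(t^2+al^2)/2} I_{m-1}(al t) dt,
   and for al = 0 its limiting value, obtained from
   al^(1-m) I_{m-1}(al t) -> (t/2)^(m-1)/(m-1)!  as al -> 0. *)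
Definition marcumQ (m : nat) (al be : R) : R :=
  if Req_EM_T al 0 then
    RInt_gen (fun t => t ^ m * exp (- (t ^ 2) / 2)
                       * ((t / 2) ^ (m - 1) / INR (Factorial.fact (m - 1))))
             (at_point be) (Rbar_locally p_infty)
  else
    / al ^ (m - 1) *
    RInt_gen (fun t => t ^ m * exp (- (t ^ 2 + al ^ 2) / 2)
                       * besselI (m - 1) (al * t))
             (at_point be) (Rbar_locally p_infty).

Definition hyp1F1 (al ga z : R) : R :=
  Series (fun l => poch al l / poch ga l * z ^ l / INR (Factorial.fact l)).

Definition humbertPhi1 (al be ga x y : R) : R :=
  Series (fun n => Series (fun l =>
    poch al (n + l) * poch be n / poch ga (n + l)
    * (x ^ n / INR (Factorial.fact n)) * (y ^ l / INR (Factorial.fact l)))).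

Definition calG (k : R) (m : nat) (a b p : R) : R :=
  RInt_gen (fun x => Rpower x (k - 1) * marcumQ m a (b * sqrt x) * exp (- (p * x)))
           (at_right 0) (Rbar_locally p_infty).

(* Main.v *)
(* With z = a^2/2 and y = beta^2/2, put P(y) = sum_j s_j y^j / j! where s_j = sum_{l <= j-m} z^l / l!.
   Since P' - P is the series of the Bessel function, e^{-z-y} P(y) is an antiderivative (in beta) of the
   Marcum integrand; it tends to 1 at infinity because s_j -> e^z, so Q_m(a, beta) = 1 - e^{-z-y} P(y),
   also for negative a and beta.  Integrating P(b^2 x/2) termwise against x^{k-1} e^{-(p + b^2/2) x}
   (all terms are nonnegative) gives Gamma(k) (p + b^2/2)^{-k} sum_j d_j s_j with
   d_j = (k)_j / j! (b^2/(b^2+2p))^j, and summing d_{n+l} z^l / l! over n >= m, l >= 0 along n + l = j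
   identifies this series with Phi_1 minus its first m rows, which are the 1F1 terms. *)
Require Import Defs.
From Stdlib Require Import Reals Factorial Lra Lia.
From Coquelicot Require Import Coquelicot.
Open Scope R_scope.

(** * Improper integrals of nonnegative functions over the half-line *)

(** The obstacle is to exchange a series with an integral that is improper at both ends. The
    integrands for which this is done are continuous and nonnegative on the open half-line, so the
    improper integral is the supremum of the proper integrals over [[u, v]] with [0 < u <= v].
    Existence, rescaling and termwise integration thereby become inequalities on compact intervals.
    This is why [1 - Q_m] is expanded and not [Q_m]: once the factor [e^{-z-y}] is split off, it is
    a power series in [y] with nonnegative coefficients and infinite radius of convergence. The
    limit of [e^{-y} P(y)] at infinity expresses the regularity of Borel summation, and is obtained
    from an explicit lower bound. Only [a^2] and [b^2] enter the expansion, and nothing in it is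
    divided by [a], so all signs and the case [a = 0] share one closed form. *)

Lemma ex_RInt_pos (f : R -> R) (u v : R) :
  (forall x, 0 < x -> continuous f x) -> 0 < u -> u <= v -> ex_RInt f u v.
Proof.
intros Hc Hu Huv; apply (ex_RInt_continuous (V := R_CompleteNormedModule)); intros x Hx.
rewrite Rmin_left in Hx by lra; apply Hc; lra.
Qed.

Lemma RInt_pos_mono (f : R -> R) (u v u' v' : R) :
  (forall x, 0 < x -> continuous f x) -> (forall x, 0 < x -> 0 <= f x) ->
  0 < u' -> u' <= u -> u <= v -> v <= v' -> RInt f u v <= RInt f u' v'.
Proof.
intros Hc Hp H0 H1 H2 H3.
assert (E : forall x y, 0 < x -> x <= y -> ex_RInt f x y)
  by (intros; apply ex_RInt_pos; auto).
rewrite <- (RInt_Chasles f u' u v') by (apply E; lra).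
rewrite <- (RInt_Chasles f u v v') by (apply E; lra).
unfold plus; simpl.
assert (0 <= RInt f u' u) by (apply RInt_ge_0; [lra | apply E; lra | intros; apply Hp; lra]).
assert (0 <= RInt f v v') by (apply RInt_ge_0; [lra | apply E; lra | intros; apply Hp; lra]).
lra.
Qed.

(** Enlarging the interval only increases the integral, so one nearly optimal [[u, v]] controls
    every larger one. This is the form in which monotone convergence is used below. *)
Lemma is_RInt_gen_pos_sup (f : R -> R) (S : R) :
  (forall x, 0 < x -> continuous f x) -> (forall x, 0 < x -> 0 <= f x) ->
  (forall u v, 0 < u -> u <= v -> RInt f u v <= S) ->
  (forall eps, 0 < eps -> exists u v, 0 < u /\ u <= v /\ S - eps < RInt f u v) ->
  is_RInt_gen f (at_right 0) (Rbar_locally p_infty) S.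
Proof.
intros Hc Hp Hle Hap P [eps HP].
destruct (Hap eps (cond_pos eps)) as [u [v [Hu [Huv HS]]]].
apply Filter_prod with (Q := fun x => 0 < x <= u) (R := fun x => v <= x).
- exists (mkposreal u Hu); intros y Hy H0.
  unfold ball in Hy; simpl in Hy; unfold AbsRing_ball, abs, minus, plus, opp in Hy; simpl in Hy.
  apply Rabs_def2 in Hy; lra.
- exists v; intros; lra.
- intros x y Hx Hy; exists (RInt f x y); split.
  + apply (RInt_correct f); simpl; apply ex_RInt_pos; auto; lra.
  + apply HP.
    unfold ball; simpl; unfold AbsRing_ball, abs, minus, plus, opp; simpl.
    assert (RInt f u v <= RInt f x y) by (apply RInt_pos_mono; auto; lra).
    assert (RInt f x y <= S) by (apply Hle; lra).
    apply Rabs_def1; destruct eps as [e He]; simpl in *; lra.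
Qed.

Lemma is_RInt_gen_pos_approx (f : R -> R) (S : R) :
  is_RInt_gen f (at_right 0) (Rbar_locally p_infty) S ->
  forall eps, 0 < eps -> exists d M, 0 < d /\
    forall u v, 0 < u < d -> M < v -> Rabs (RInt f u v - S) < eps.
Proof.
intros H eps He.
destruct (H (ball S (mkposreal eps He)) (locally_ball S (mkposreal eps He)))
  as [Q T [d Hd] [M HM] HQT].
exists d, M; split; [apply cond_pos | intros u v Hu Hv].
destruct (HQT u v) as [l [Hl Hb]].
- apply Hd; [|lra].
  unfold ball; simpl; unfold AbsRing_ball, abs, minus, plus, opp; simpl.
  apply Rabs_def1; lra.
- apply HM, Hv.
- simpl in Hl; rewrite (is_RInt_unique (V := R_CompleteNormedModule) _ _ _ _ Hl); exact Hb.
Qed.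

(** Converse of [is_RInt_gen_pos_sup]. A proper integral above [S] would stay above it on all larger
    intervals, against the limit. It brings a known improper integral back to compact intervals. *)
Lemma is_RInt_gen_pos_inv (f : R -> R) (S : R) :
  (forall x, 0 < x -> continuous f x) -> (forall x, 0 < x -> 0 <= f x) ->
  is_RInt_gen f (at_right 0) (Rbar_locally p_infty) S ->
  (forall u v, 0 < u -> u <= v -> RInt f u v <= S) /\
  (forall eps, 0 < eps -> exists u v, 0 < u /\ u <= v /\ S - eps < RInt f u v).
Proof.
intros Hc Hp H; split.
- intros u v Hu Huv; apply Rnot_lt_le; intro Hn.
  destruct (is_RInt_gen_pos_approx f S H (RInt f u v - S) ltac:(lra)) as [d [M [Hd HM]]].
  pose (u' := Rmin u (d / 2)); pose (v' := Rmax v (M + 1)).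
  assert (0 < u') by (apply Rmin_glb_lt; lra).
  assert (u' <= u) by apply Rmin_l.
  assert (u' <= d / 2) by apply Rmin_r.
  assert (v <= v') by apply Rmax_l.
  assert (M + 1 <= v') by apply Rmax_r.
  specialize (HM u' v' ltac:(lra) ltac:(lra)).
  assert (RInt f u v <= RInt f u' v') by (apply RInt_pos_mono; auto; lra).
  apply Rabs_def2 in HM; lra.
- intros eps He.
  destruct (is_RInt_gen_pos_approx f S H eps He) as [d [M [Hd HM]]].
  pose (v' := Rmax d (M + 1)).
  assert (d <= v') by apply Rmax_l.
  assert (M + 1 <= v') by apply Rmax_r.
  exists (d / 2), v'; repeat split; try lra.
  specialize (HM (d / 2) v' ltac:(lra) ltac:(lra)).
  apply Rabs_def2 in HM; lra.
Qed.

(** On [[u, v]] the integral of [f] is at most [g v - g u <= C]; completeness of the reals then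
    supplies the supremum. *)
Lemma ex_RInt_gen_pos (f g dg : R -> R) (C : R) :
  (forall x, 0 < x -> continuous f x) -> (forall x, 0 < x -> 0 <= f x) ->
  (forall x, 0 < x -> is_derive g x (dg x)) -> (forall x, 0 < x -> continuous dg x) ->
  (forall x, 0 < x -> 0 <= g x <= C) -> (forall x, 0 < x -> f x <= dg x) ->
  ex_RInt_gen f (at_right 0) (Rbar_locally p_infty).
Proof.
intros Hc Hp Hg Hdg HC Hle.
assert (B : forall u v, 0 < u -> u <= v -> RInt f u v <= C).
{ intros u v Hu Huv.
  assert (E : is_RInt dg u v (minus (g v) (g u))).
  { apply (is_RInt_derive g dg); rewrite Rmin_left by lra; intros; [apply Hg | apply Hdg]; lra. }
  apply Rle_trans with (RInt dg u v).
  - apply RInt_le; auto.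
    + apply ex_RInt_pos; auto.
    + eexists; apply E.
    + intros; apply Hle; lra.
  - rewrite (is_RInt_unique (V := R_CompleteNormedModule) _ _ _ _ E); unfold minus, plus, opp; simpl.
    assert (Gu := HC u Hu); assert (Gv := HC v ltac:(lra)); lra. }
destruct (completeness (fun r => exists u v, 0 < u /\ u <= v /\ r = RInt f u v)) as [S [HS1 HS2]].
- exists C; intros r [u [v [Hu [Huv ->]]]]; auto.
- exists (RInt f 1 1), 1, 1; repeat split; lra.
- exists S; apply is_RInt_gen_pos_sup; auto.
  + intros u v Hu Huv; apply HS1; exists u, v; auto.
  + intros eps He; apply Classical_Prop.NNPP; intro Hn.
    assert (S <= S - eps); [|lra].
    apply HS2; intros r [u [v [Hu [Huv ->]]]].
    apply Rnot_lt_le; intro; apply Hn; exists u, v; auto.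
Qed.

Lemma filter_prod_pos_le :
  filter_prod (at_right 0) (Rbar_locally p_infty) (fun ab => 0 < fst ab <= snd ab).
Proof.
apply Filter_prod with (Q := fun x => 0 < x < 1) (R := fun x => 1 < x).
- exists (mkposreal 1 Rlt_0_1); intros y Hy H0.
  unfold ball in Hy; simpl in Hy; unfold AbsRing_ball, abs, minus, plus, opp in Hy; simpl in Hy.
  apply Rabs_def2 in Hy; lra.
- exists 1; auto.
- simpl; intros; lra.
Qed.

Lemma is_RInt_gen_pos_ext (f g : R -> R) (S : R) :
  (forall x, 0 < x -> f x = g x) ->
  is_RInt_gen f (at_right 0) (Rbar_locally p_infty) S ->
  is_RInt_gen g (at_right 0) (Rbar_locally p_infty) S.
Proof.
intros E; apply is_RInt_gen_ext.
generalize filter_prod_pos_le; apply filter_imp; intros [x y]; simpl; intros H t Ht.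
rewrite Rmin_left in Ht by lra; apply E; lra.
Qed.

Lemma is_RInt_gen_pos_derive (h dh : R -> R) (la lb : R) :
  (forall x, 0 < x -> is_derive h x (dh x)) -> (forall x, 0 < x -> continuous dh x) ->
  filterlim h (at_right 0) (locally la) -> filterlim h (Rbar_locally p_infty) (locally lb) ->
  is_RInt_gen dh (at_right 0) (Rbar_locally p_infty) (lb - la).
Proof.
intros Hd Hdc Ha Hb.
apply (is_RInt_gen_pos_ext (Derive h)).
{ intros x Hx; apply is_derive_unique, Hd, Hx. }
apply is_RInt_gen_Derive; try assumption;
  generalize filter_prod_pos_le; apply filter_imp; intros [x y]; simpl; intros H t Ht;
  rewrite Rmin_left in Ht by lra.
- eexists; apply Hd; lra.
- apply continuous_ext_loc with dh; [|apply Hdc; lra].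
  (* The ball of radius [t] about [t] stays in the positive reals, the only place where [Derive h]
     is known to equal [dh]. *)
  exists (mkposreal t ltac:(lra)); intros s Hs.
  unfold ball in Hs; simpl in Hs; unfold AbsRing_ball, abs, minus, plus, opp in Hs; simpl in Hs.
  apply Rabs_def2 in Hs; symmetry; apply is_derive_unique, Hd; lra.
Qed.

(** * The Gamma function *)

Lemma ln_le_sub1 (x : R) : 0 < x -> ln x <= x - 1.
Proof.
intros Hx; assert (H := exp_ineq1_le (ln x)); rewrite exp_ln in H by assumption; lra.
Qed.

Lemma Gamma_integrand_continuous (k q x : R) :
  0 < x -> continuous (fun t => Rpower t (k - 1) * exp (- (q * t))) x.
Proof.
intros Hx; apply (ex_derive_continuous (V := R_NormedModule)).
unfold Rpower; auto_derive; assumption.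
Qed.

Lemma Gamma_integrand_pos (k q x : R) : 0 < Rpower x (k - 1) * exp (- (q * x)).
Proof. unfold Rpower; apply Rmult_lt_0_compat; apply exp_pos. Qed.

(* The maximum of [(1 + x)^s e^{-x}], located at [x = s - 1]. *)
Definition poly_exp_max (s : R) : R := exp (s * ln s - s + 1).

(** The inequality [ln u <= u - 1] at [u = (1 + x) / s], multiplied by [s]. *)
Lemma poly_exp_bound (s x : R) :
  0 < s -> 0 < x -> exp (s * ln (1 + x)) * exp (- x) <= poly_exp_max s.
Proof.
intros Hs Hx; unfold poly_exp_max; rewrite <- exp_plus.
assert (Hl : ln (1 + x) <= ln s + ((1 + x) / s - 1)).
{ replace (1 + x) with (s * ((1 + x) / s)) at 1 by (field; lra).
  assert (0 < (1 + x) / s) by (apply Rdiv_lt_0_compat; lra).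
  rewrite ln_mult by lra; assert (H1 := ln_le_sub1 _ H); lra. }
apply (Rmult_le_compat_l s) in Hl; [|lra].
replace (s * (ln s + ((1 + x) / s - 1))) with (s * ln s + 1 + x - s) in Hl by (field; lra).
destruct (Rle_lt_or_eq_dec (s * ln (1 + x) + - x) (s * ln s - s + 1)) as [H | ->]; [lra | |lra].
apply Rlt_le, exp_increasing, H.
Qed.

(* The integrand is dominated by the derivative of a multiple of [(x / (1 + x))^k]. *)
Lemma ex_Gamma_integral (k : R) : 0 < k ->
  ex_RInt_gen (fun t => Rpower t (k - 1) * exp (- t)) (at_right 0) (Rbar_locally p_infty).
Proof.
intros Hk.
(* The derivative of [(x / (1 + x))^k] is [k x^{k-1} (1 + x)^{-(k+1)}], so domination asks for
   [C k >= (1 + x)^{k+1} e^{-x}]. *)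
pose (C := poly_exp_max (k + 1) / k).
assert (HC : 0 < C) by (apply Rdiv_lt_0_compat; [apply exp_pos | assumption]).
apply ex_RInt_gen_pos with (C := C)
  (g := fun x => C * exp (k * (ln x - ln (1 + x))))
  (dg := fun x => C * (exp (k * (ln x - ln (1 + x))) * (k * (/ x - / (1 + x))))).
- intros x Hx; apply continuous_ext with (fun t => Rpower t (k - 1) * exp (- (1 * t))).
  + intros t; now rewrite Rmult_1_l.
  + now apply Gamma_integrand_continuous.
- intros x Hx; rewrite <- (Rmult_1_l x) at 2; apply Rlt_le, Gamma_integrand_pos.
- intros x Hx; unfold Rminus; auto_derive; [repeat split; lra | ring].
- intros x Hx; apply (ex_derive_continuous (V := R_NormedModule)); auto_derive; repeat split; lra.
- intros x Hx; split.
  + apply Rlt_le, Rmult_lt_0_compat; [assumption | apply exp_pos].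
  + rewrite <- (Rmult_1_r C) at 2; apply Rmult_le_compat_l; [lra|].
    apply Rle_trans with (exp 0); [|rewrite exp_0; lra]; apply Rlt_le, exp_increasing.
    assert (ln x < ln (1 + x)) by (apply ln_increasing; lra).
    assert (0 < k * (ln (1 + x) - ln x)) by (apply Rmult_lt_0_compat; lra); lra.
- intros x Hx.
  assert (E : exp (k * (ln x - ln (1 + x))) * (k * (/ x - / (1 + x)))
     = k * (Rpower x (k - 1) * exp (- ((k + 1) * ln (1 + x))))).
  { replace (/ x - / (1 + x)) with (exp (- ln x - ln (1 + x))).
    - unfold Rpower.
      replace (exp (k * (ln x - ln (1 + x))) * (k * exp (- ln x - ln (1 + x))))
        with (k * (exp (k * (ln x - ln (1 + x))) * exp (- ln x - ln (1 + x)))) by ring.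
      rewrite <- !exp_plus; do 2 f_equal; ring.
    - unfold Rminus at 1; rewrite exp_plus, !exp_Ropp, !exp_ln by lra; field; lra. }
  rewrite E; unfold C.
  replace (poly_exp_max (k + 1) / k * (k * (Rpower x (k - 1) * exp (- ((k + 1) * ln (1 + x))))))
    with (Rpower x (k - 1) * (poly_exp_max (k + 1) * exp (- ((k + 1) * ln (1 + x))))) by (field; lra).
  apply Rmult_le_compat_l; [apply Rlt_le, exp_pos|].
  assert (HM := poly_exp_bound (k + 1) x ltac:(lra) Hx).
  apply (Rmult_le_compat_r (exp (- ((k + 1) * ln (1 + x))))) in HM; [|apply Rlt_le, exp_pos].
  eapply Rle_trans; [|exact HM]; apply Req_le.
  rewrite <- !exp_plus; f_equal; ring.
Qed.

Lemma is_Gamma (k : R) : 0 < k ->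
  is_RInt_gen (fun t => Rpower t (k - 1) * exp (- t)) (at_right 0) (Rbar_locally p_infty) (Gamma k).
Proof. intros Hk; apply (RInt_gen_correct (V := R_CompleteNormedModule)), ex_Gamma_integral, Hk. Qed.

Lemma is_Gamma_1 (k : R) : 0 < k ->
  is_RInt_gen (fun t => Rpower t (k - 1) * exp (- (1 * t))) (at_right 0) (Rbar_locally p_infty) (Gamma k).
Proof.
intros Hk; apply (is_RInt_gen_ext (fun t => Rpower t (k - 1) * exp (- t))).
- apply filter_forall; intros ab t _; now rewrite Rmult_1_l.
- now apply is_Gamma.
Qed.

Lemma Gamma_pos (k : R) : 0 < k -> 0 < Gamma k.
Proof.
intros Hk.
destruct (is_RInt_gen_pos_inv _ _
  (fun x H => Gamma_integrand_continuous k 1 x H)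
  (fun x _ => Rlt_le _ _ (Gamma_integrand_pos k 1 x)) (is_Gamma_1 k Hk)) as [H _].
eapply Rlt_le_trans; [|apply (H 1 2); lra].
apply RInt_gt_0; [lra | intros; apply Gamma_integrand_pos|].
intros; apply Gamma_integrand_continuous; lra.
Qed.

(** The substitution [t -> q t] is made on compact intervals, where the Jacobian [q] and the factor
    [q^{k-1}] combine to [q^k]. The supremum is then carried over, with precision [eps * q^k] on the
    side of [Gamma k]. *)
Lemma is_Gamma_scaled (k q : R) : 0 < k -> 0 < q ->
  is_RInt_gen (fun t => Rpower t (k - 1) * exp (- (q * t)))
    (at_right 0) (Rbar_locally p_infty) (Gamma k / Rpower q k).
Proof.
intros Hk Hq.
set (f := fun t => Rpower t (k - 1) * exp (- (1 * t))).
assert (Hc : forall x, 0 < x -> continuous f x) by (intros; now apply Gamma_integrand_continuous).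
destruct (is_RInt_gen_pos_inv f (Gamma k) Hc
  (fun x _ => Rlt_le _ _ (Gamma_integrand_pos k 1 x)) (is_Gamma_1 k Hk)) as [H1 H2].
assert (Hqk : 0 < Rpower q k) by apply exp_pos.
assert (E : forall u v, 0 < u -> u <= v ->
  RInt (fun t => Rpower t (k - 1) * exp (- (q * t))) u v = RInt f (q * u) (q * v) / Rpower q k).
{ intros u v Hu Huv.
  assert (0 < q * u) by (apply Rmult_lt_0_compat; lra).
  assert (q * u <= q * v) by (apply Rmult_le_compat_l; lra).
  assert (Hi : ex_RInt f (q * u + 0) (q * v + 0)) by (rewrite !Rplus_0_r; now apply ex_RInt_pos).
  rewrite <- (Rplus_0_r (q * u)), <- (Rplus_0_r (q * v)), <- (RInt_comp_lin f q 0 u v Hi).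
  unfold Rdiv; rewrite Rmult_comm.
  rewrite <- (RInt_scal (V := R_CompleteNormedModule)).
  - apply RInt_ext; intros x; rewrite Rmin_left by lra; intros Hx.
    unfold scal; simpl; unfold mult; simpl; unfold f.
    rewrite Rmult_1_l, Rplus_0_r.
    rewrite <- Rpower_mult_distr by lra.
    replace (Rpower q k) with (q * Rpower q (k - 1)).
    + assert (0 < Rpower q (k - 1)) by apply exp_pos; field; lra.
    + rewrite <- (Rpower_1 q) at 1 by assumption; rewrite <- Rpower_plus; f_equal; ring.
  - apply (ex_RInt_comp_lin f q 0 u v Hi). }
apply is_RInt_gen_pos_sup.
- intros; now apply Gamma_integrand_continuous.
- intros; apply Rlt_le, Gamma_integrand_pos.
- intros u v Hu Huv; rewrite E by assumption.
  apply Rmult_le_compat_r; [apply Rlt_le, Rinv_0_lt_compat, Hqk|].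
  apply H1; [apply Rmult_lt_0_compat; lra | apply Rmult_le_compat_l; lra].
- intros eps He.
  destruct (H2 (eps * Rpower q k)) as [u [v [Hu [Huv HS]]]]; [now apply Rmult_lt_0_compat|].
  exists (u / q), (v / q).
  assert (0 < u / q) by (apply Rdiv_lt_0_compat; lra).
  assert (u / q <= v / q) by (apply Rmult_le_compat_r; [apply Rlt_le, Rinv_0_lt_compat|]; lra).
  repeat split; auto; rewrite E by assumption.
  replace (q * (u / q)) with u by (field; lra).
  replace (q * (v / q)) with v by (field; lra).
  apply (Rmult_lt_reg_r (Rpower q k)); [assumption|].
  replace ((Gamma k / Rpower q k - eps) * Rpower q k) with (Gamma k - eps * Rpower q k) by (field; lra).
  unfold Rdiv; rewrite Rmult_assoc, Rinv_l, Rmult_1_r by lra; exact HS.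
Qed.

Lemma Rpower_filterlim_0 (k : R) : 0 < k ->
  filterlim (fun x => exp (k * ln x)) (at_right 0) (locally 0).
Proof.
intros Hk.
apply (filterlim_comp _ _ _ (fun x => k * ln x) exp _ (Rbar_locally m_infty)).
- apply (filterlim_comp _ _ _ ln (fun y => k * y) _ (Rbar_locally m_infty)).
  + apply is_lim_ln_0.
  + intros P [M HM]; exists (M / k); intros x Hx; apply HM.
    apply (Rmult_lt_compat_l k) in Hx; [|assumption].
    replace (k * (M / k)) with M in Hx by (field; lra); exact Hx.
- apply is_lim_exp_m.
Qed.

(** Since [x^{k+1} <= (1 + x)^{k+1}], the bound [poly_exp_bound] at exponent [k + 1] leaves a spare
    factor [1 / x]. *)
Lemma Rpower_exp_filterlim_infty (k : R) : 0 < k ->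
  filterlim (fun x => exp (k * ln x) * exp (- x)) (Rbar_locally p_infty) (locally 0).
Proof.
intros Hk.
set (C := poly_exp_max (k + 1)).
apply (filterlim_le_le (F := Rbar_locally p_infty) (fun _ => 0) _ (fun x => C * / x) (Finite 0)).
- exists 0; intros x Hx; split.
  + apply Rlt_le, Rmult_lt_0_compat; apply exp_pos.
  + apply (Rmult_le_reg_r x); [assumption|].
    replace (C * / x * x) with C by (field; lra).
    eapply Rle_trans; [|apply (poly_exp_bound (k + 1) x); lra].
    replace (exp (k * ln x) * exp (- x) * x) with (exp (k * ln x) * exp (ln x) * exp (- x))
      by (rewrite (exp_ln x) by assumption; ring).
    apply Rmult_le_compat_r; [apply Rlt_le, exp_pos|].
    rewrite <- exp_plus; apply Rlt_le, exp_increasing.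
    replace (k * ln x + ln x) with ((k + 1) * ln x) by ring.
    apply Rmult_lt_compat_l; [lra | apply ln_increasing; lra].
- apply filterlim_const.
- replace (Finite 0) with (Rbar_mult C 0) by (simpl; f_equal; ring).
  apply (is_lim_scal_l Rinv C p_infty 0).
  apply (is_lim_inv (fun x => x) p_infty p_infty); [apply is_lim_id | easy].
Qed.

Lemma exp_opp_filterlim_0 : filterlim (fun x => exp (- x)) (at_right 0) (locally 1).
Proof.
assert (Hce : continuous (fun x => exp (- x)) 0)
  by (apply (ex_derive_continuous (V := R_NormedModule)); auto_derive; auto).
unfold continuous in Hce; rewrite Ropp_0, exp_0 in Hce.
intros P HP; destruct (Hce P HP) as [d Hd]; exists d; intros; now apply Hd.
Qed.

Lemma Gamma_1 : Gamma 1 = 1.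
Proof.
unfold Gamma; apply (is_RInt_gen_unique (V := R_CompleteNormedModule)).
apply (is_RInt_gen_pos_ext (fun x => exp (- x))).
{ intros x Hx; unfold Rpower, Rminus; now rewrite Rplus_opp_r, Rmult_0_l, exp_0, Rmult_1_l. }
replace 1 with (- 0 - - (1)) by ring.
apply (is_RInt_gen_pos_derive (fun x => - exp (- x))).
- intros x Hx; auto_derive; [trivial | ring].
- intros x Hx; apply (ex_derive_continuous (V := R_NormedModule)); auto_derive; trivial.
- eapply filterlim_comp; [apply exp_opp_filterlim_0 | apply (filterlim_opp (V := R_NormedModule))].
- eapply filterlim_comp; [|apply (filterlim_opp (V := R_NormedModule))].
  apply (filterlim_comp _ _ _ Ropp exp _ (Rbar_locally m_infty)); [|apply is_lim_exp_m].
  intros P [M HM]; exists (- M); intros x Hx; apply HM; lra.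
Qed.

(** Integration by parts: [dh] is the derivative of [x^k e^{-x}], which vanishes at both ends, so
    the integral of [dh] is 0. Linearity evaluates the same integral as
    [k * Gamma k - Gamma (k + 1)]. *)
Lemma Gamma_succ (k : R) : 0 < k -> Gamma (k + 1) = k * Gamma k.
Proof.
intros Hk.
set (h := fun x => exp (k * ln x) * exp (- x)).
set (dh := fun x => k * (Rpower x (k - 1) * exp (- x)) - Rpower x (k + 1 - 1) * exp (- x)).
assert (I0 : is_RInt_gen dh (at_right 0) (Rbar_locally p_infty) (0 - 0)).
{ apply (is_RInt_gen_pos_derive h).
  - intros x Hx; unfold h, dh; auto_derive; [assumption|].
    replace (k + 1 - 1) with k by ring.
    replace (/ x) with (exp (- ln x)) by (rewrite exp_Ropp, exp_ln by assumption; reflexivity).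
    unfold Rpower.
    replace ((k - 1) * ln x) with (k * ln x + - ln x) by ring; rewrite exp_plus; ring.
  - intros x Hx; apply (ex_derive_continuous (V := R_NormedModule)); unfold dh, Rpower.
    auto_derive; repeat split; lra.
  - replace 0 with (0 * 1) at 2 by ring.
    eapply filterlim_comp_2; [apply Rpower_filterlim_0, Hk | apply exp_opp_filterlim_0 |].
    apply (filterlim_mult (K := R_AbsRing)).
  - apply Rpower_exp_filterlim_infty, Hk. }
assert (I1 := is_RInt_gen_minus _ _ _ _ (is_RInt_gen_scal _ k _ (is_Gamma k Hk))
                (is_Gamma (k + 1) ltac:(lra))).
assert (E := is_RInt_gen_unique (V := R_CompleteNormedModule) _ _ I1).
assert (E' := is_RInt_gen_unique (V := R_CompleteNormedModule) _ _ I0).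
unfold minus, scal, plus, opp in E; simpl in E; unfold mult in E; simpl in E.
change (RInt_gen dh (at_right 0) (Rbar_locally p_infty) = k * Gamma k + - Gamma (k + 1)) in E.
lra.
Qed.

Lemma Gamma_fact (n : nat) : Gamma (INR n + 1) = INR (fact n).
Proof.
induction n as [|n IH].
- now rewrite Rplus_0_l, Gamma_1.
- rewrite Gamma_succ, S_INR, IH by (apply lt_0_INR; lia).
  rewrite fact_simpl, mult_INR, S_INR; reflexivity.
Qed.

Lemma Gamma_add_pos (k : R) (n : nat) : 0 < k -> 0 < Gamma (k + INR n).
Proof. intros Hk; apply Gamma_pos; assert (H := pos_INR n); lra. Qed.

Lemma poch_add (k : R) (n l : nat) : 0 < k -> poch k n * poch (k + INR n) l = poch k (n + l).
Proof.
intros Hk; unfold poch; rewrite plus_INR, <- Rplus_assoc.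
assert (H1 := Gamma_pos k Hk); assert (H2 := Gamma_add_pos k n Hk); field; lra.
Qed.

Lemma poch_INR (n l : nat) : poch (INR n + 1) l = INR (fact (n + l)) / INR (fact n).
Proof.
unfold poch; replace (INR n + 1 + INR l) with (INR (n + l) + 1) by (rewrite plus_INR; ring).
now rewrite !Gamma_fact.
Qed.

Lemma poch_1 (n : nat) : poch 1 n = INR (fact n).
Proof.
replace 1 with (INR 0 + 1) at 1 by (simpl; ring).
rewrite poch_INR; simpl; field.
Qed.

(** * Series with nonnegative terms *)

Lemma is_series_lim (a : nat -> R) (S : R) : is_series a S <-> is_lim_seq (sum_f_R0 a) S.
Proof.
split; intros H.
- apply is_lim_seq_ext with (sum_n a); [intros; apply sum_n_Reals | exact H].
- apply is_lim_seq_ext with (u := sum_f_R0 a) (v := sum_n a) in H;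
    [exact H | intros; symmetry; apply sum_n_Reals].
Qed.

Lemma sum_f_R0_le_sum (a : nat -> R) (N M : nat) :
  (forall n, 0 <= a n) -> (N <= M)%nat -> sum_f_R0 a N <= sum_f_R0 a M.
Proof.
intros Ha; induction 1 as [|M _ IH]; [lra|]; simpl; specialize (Ha (S M)); lra.
Qed.

Lemma sum_f_R0_le_series (a : nat -> R) (S : R) (N : nat) :
  (forall n, 0 <= a n) -> is_series a S -> sum_f_R0 a N <= S.
Proof.
intros Ha H; apply is_series_lim in H.
apply (is_lim_seq_incr_compare _ _ H); intros n; apply sum_f_R0_le_sum; auto.
Qed.

Lemma ex_series_bounded (a : nat -> R) (M : R) :
  (forall n, 0 <= a n) -> (forall N, sum_f_R0 a N <= M) -> ex_series a /\ Series a <= M.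
Proof.
intros Ha HM.
destruct (ex_finite_lim_seq_incr (sum_f_R0 a) M) as [S HS]; auto.
{ intros n; apply sum_f_R0_le_sum; auto. }
assert (H : is_series a S) by now apply is_series_lim.
split; [now exists S|].
rewrite (is_series_unique _ _ H).
apply (is_lim_seq_le _ (fun _ => M) S M HM HS), is_lim_seq_const.
Qed.

Lemma sum_f_R0_antidiagonal (v : nat -> nat -> R) (J : nat) :
  sum_f_R0 (fun j => sum_f_R0 (fun l => v l (j - l)%nat) j) J =
  sum_f_R0 (fun l => sum_f_R0 (v l) (J - l)) J.
Proof.
induction J as [|J IH]; [reflexivity|].
rewrite tech5, IH, (tech5 (fun l => v l (S J - l)%nat)), <- Rplus_assoc, <- plus_sum.
rewrite (tech5 (fun l => sum_f_R0 (v l) (S J - l))).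
rewrite Nat.sub_diag; simpl (sum_f_R0 (v (S J)) 0); f_equal.
apply sum_eq; intros l Hl.
replace (S J - l)%nat with (S (J - l)) by lia; reflexivity.
Qed.

Lemma sum_f_R0_switch (u : nat -> nat -> R) (N L : nat) :
  sum_f_R0 (fun n => sum_f_R0 (u n) L) N = sum_f_R0 (fun l => sum_f_R0 (fun n => u n l) N) L.
Proof.
induction N as [|N IH]; [reflexivity|].
rewrite tech5, IH, <- plus_sum; reflexivity.
Qed.

(** A Tonelli argument. The rectangle [N] by [L] lies in the triangle of size [N + L], so rectangle
    sums are at most [S]; letting [L] grow bounds the sum of the rows. Conversely the triangle of
    size [J] lies in the square of side [J], so [S] is at most the sum of the rows. *)
Lemma series_antidiagonal (u : nat -> nat -> R) (S : R) :
  (forall n l, 0 <= u n l) ->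
  is_series (fun j => sum_f_R0 (fun l => u (j - l)%nat l) j) S ->
  (forall n, ex_series (u n)) /\ is_series (fun n => Series (u n)) S.
Proof.
intros Hu HS.
set (v := fun l n => u n l).
assert (Hv : forall l n, 0 <= v l n) by (intros; apply Hu).
assert (Hsv : forall l N, 0 <= sum_f_R0 (v l) N) by (intros; apply cond_pos_sum; auto).
assert (Hsu : forall n N, 0 <= sum_f_R0 (u n) N) by (intros; apply cond_pos_sum; auto).
assert (Hc : forall J, sum_f_R0 (fun l => sum_f_R0 (v l) (J - l)) J <= S).
{ intros J; rewrite <- sum_f_R0_antidiagonal.
  apply (sum_f_R0_le_series _ _ J) in HS; [exact HS|].
  intros j; apply cond_pos_sum; intros l; apply Hu. }
assert (Hr : forall N L, sum_f_R0 (fun n => sum_f_R0 (u n) L) N <= S).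
{ intros N L; rewrite sum_f_R0_switch.
  apply Rle_trans with (2 := Hc (N + L)%nat).
  apply Rle_trans with (sum_f_R0 (fun l => sum_f_R0 (v l) (N + L - l)) L).
  - apply sum_Rle; intros l Hl; apply (sum_f_R0_le_sum (v l)); [auto | lia].
  - apply (sum_f_R0_le_sum (fun l => sum_f_R0 (v l) (N + L - l))); [auto | lia]. }
assert (Hex : forall n, ex_series (u n)).
{ intros n; apply (ex_series_bounded (u n) S); auto.
  intros L; apply Rle_trans with (2 := Hr n L).
  clear -Hsu; destruct n as [|n]; [apply Rle_refl|].
  rewrite tech5; assert (0 <= sum_f_R0 (fun n => sum_f_R0 (u n) L) n)
    by (apply cond_pos_sum; auto); lra. }
assert (Hle : forall n L, sum_f_R0 (u n) L <= Series (u n)).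
{ intros n L; apply sum_f_R0_le_series; auto; apply Series_correct, Hex. }
assert (Hpos : forall n, 0 <= Series (u n)).
{ intros n; apply Rle_trans with (2 := Hle n 0%nat), Hsu. }
split; [exact Hex|].
destruct (ex_series_bounded (fun n => Series (u n)) S) as [Ex Ub]; auto.
{ intros N.
  apply (is_lim_seq_le (fun L => sum_f_R0 (fun n => sum_f_R0 (u n) L) N) (fun _ => S)
          (sum_f_R0 (fun n => Series (u n)) N) S); [auto | | apply is_lim_seq_const].
  induction N as [|N IH].
  - apply is_series_lim, Series_correct, Hex.
  - simpl; apply (is_lim_seq_plus' _ _ _ _ IH), is_series_lim, Series_correct, Hex. }
replace S with (Series (fun n => Series (u n))); [now apply Series_correct|].
apply Rle_antisym; [exact Ub|].
apply is_series_lim in HS.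
apply (is_lim_seq_le (sum_f_R0 (fun j => sum_f_R0 (fun l => u (j - l)%nat l) j))
        (fun _ => Series (fun n => Series (u n))) S (Series (fun n => Series (u n))));
  [|exact HS | apply is_lim_seq_const].
intros J.
rewrite (sum_f_R0_antidiagonal v).
apply Rle_trans with (sum_f_R0 (fun n => Series (u n)) J).
- apply Rle_trans with (sum_f_R0 (fun l => sum_f_R0 (v l) J) J).
  + apply sum_Rle; intros l Hl; apply sum_f_R0_le_sum; [auto | lia].
  + rewrite sum_f_R0_switch; apply sum_Rle; intros n _; apply Hle.
- apply sum_f_R0_le_series; auto; now apply Series_correct.
Qed.

Lemma is_series_le (a b : nat -> R) (A B : R) :
  (forall n, a n <= b n) -> is_series a A -> is_series b B -> A <= B.
Proof.
intros H HA HB.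
apply (is_lim_seq_le (sum_f_R0 a) (sum_f_R0 b) A B); [|now apply is_series_lim..].
intros n; apply sum_Rle; auto.
Qed.

(** * Termwise integration against a Gamma density *)

(** With nonnegative coefficients the tail is itself a nondecreasing function on the half-line. The
    error at the right end of an interval is therefore a uniform error on it. *)
Lemma PSeries_tail_le (c : nat -> R) (N : nat) (x y : R) :
  (forall j, 0 <= c j) -> CV_radius c = p_infty -> 0 <= x -> x <= y ->
  0 <= PSeries c x - sum_f_R0 (fun j => c j * x ^ j) N
    <= PSeries c y - sum_f_R0 (fun j => c j * y ^ j) N.
Proof.
intros Hc HR Hx Hxy.
assert (Ex : forall r, ex_series (fun j => c j * r ^ j)).
{ intros r; apply ex_series_Rabs, CV_disk_inside; rewrite HR; exact I. }
assert (E : forall r, PSeries c r - sum_f_R0 (fun j => c j * r ^ j) N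
   = Series (fun j => c (S N + j)%nat * r ^ (S N + j))).
{ intros r; unfold PSeries; rewrite (Series_incr_n _ (S N)) by (auto; lia); simpl; ring. }
assert (Ey : ex_series (fun j => c (S N + j)%nat * y ^ (S N + j)))
  by (apply (ex_series_incr_n (fun j => c j * y ^ j) (S N)); auto).
rewrite !E; split.
- replace 0 with (Series (fun _ : nat => 0)).
  + apply Series_le; [|apply (ex_series_incr_n (fun j => c j * x ^ j) (S N)); auto].
    intros j; split; [lra | apply Rmult_le_pos; [apply Hc | now apply pow_le]].
  + apply is_series_unique, is_series_lim.
    apply is_lim_seq_ext with (fun _ => 0); [|apply is_lim_seq_const].
    intros n; symmetry; apply sum_eq_R0; auto.
- apply Series_le; [|assumption].
  intros j; split; [apply Rmult_le_pos; [apply Hc | now apply pow_le]|].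
  apply Rmult_le_compat_l; [apply Hc | now apply pow_incr].
Qed.

Lemma PSeries_continuous (c : nat -> R) (x : R) :
  CV_radius c = p_infty -> continuous (PSeries c) x.
Proof.
intros HR; apply continuity_pt_filterlim, PSeries_continuity; rewrite HR; exact I.
Qed.

Lemma is_RInt_gen_Gamma_PSeries (k q : R) (c : nat -> R) (S : R) :
  0 < k -> 0 < q -> (forall j, 0 <= c j) -> CV_radius c = p_infty ->
  is_series (fun j => c j * (Gamma (k + INR j) / Rpower q (k + INR j))) S ->
  is_RInt_gen (fun x => Rpower x (k - 1) * exp (- (q * x)) * PSeries c x)
    (at_right 0) (Rbar_locally p_infty) S.
Proof.
intros Hk Hq Hc HR HS.
set (w := fun x => Rpower x (k - 1) * exp (- (q * x))).
set (pc := fun N x => sum_f_R0 (fun j => c j * x ^ j) N).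
set (SN := sum_f_R0 (fun j => c j * (Gamma (k + INR j) / Rpower q (k + INR j)))).
assert (Hw : forall x, 0 < w x) by (intros; apply Gamma_integrand_pos).
assert (Hwc : forall x, 0 < x -> continuous w x) by (intros; now apply Gamma_integrand_continuous).
assert (Hpcp : forall N x, 0 < x -> 0 <= pc N x).
{ intros N x Hx; apply cond_pos_sum; intros j; apply Rmult_le_pos; [apply Hc | apply pow_le; lra]. }
assert (Hpcc : forall N x, continuous (pc N) x).
{ intros N x; apply (ex_derive_continuous (V := R_NormedModule)); unfold pc.
  induction N as [|N IH]; simpl.
  - auto_derive; trivial.
  - apply (ex_derive_plus (V := R_NormedModule)); [exact IH | auto_derive; trivial]. }
assert (HfN : forall N, is_RInt_gen (fun x => w x * pc N x) (at_right 0) (Rbar_locally p_infty) (SN N)).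
{ assert (T : forall j, is_RInt_gen (fun x => scal (c j) (w x * x ^ j)) (at_right 0) (Rbar_locally p_infty)
      (c j * (Gamma (k + INR j) / Rpower q (k + INR j)))).
  { intros j; apply (is_RInt_gen_scal (V := R_NormedModule)).
    apply (is_RInt_gen_pos_ext (fun x => Rpower x (k + INR j - 1) * exp (- (q * x)))).
    - intros x Hx; unfold w.
      replace (k + INR j - 1) with (k - 1 + INR j) by ring.
      rewrite Rpower_plus, Rpower_pow by assumption; ring.
    - apply is_Gamma_scaled; [assert (H := pos_INR j); lra | assumption]. }
  induction N as [|N IH].
  - refine (is_RInt_gen_pos_ext _ _ _ _ (T 0%nat)).
    intros x _; unfold pc, scal; simpl; unfold mult; simpl; ring.
  - refine (is_RInt_gen_pos_ext _ _ _ _ (is_RInt_gen_plus _ _ _ _ IH (T (Datatypes.S N)))).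
    intros x _; unfold pc, scal, plus; simpl; unfold mult; simpl; ring. }
assert (Hinv := fun N => is_RInt_gen_pos_inv (fun x => w x * pc N x) (SN N)
  (fun x Hx => continuous_mult (K := R_AbsRing) w (pc N) x (Hwc x Hx) (Hpcc N x))
  (fun x Hx => Rmult_le_pos _ _ (Rlt_le _ _ (Hw x)) (Hpcp N x Hx)) (HfN N)).
assert (HSN : forall N, SN N <= S).
{ intros N; apply sum_f_R0_le_series; [|exact HS].
  intros j; apply Rmult_le_pos; [apply Hc|]; apply Rlt_le, Rdiv_lt_0_compat;
    [now apply Gamma_add_pos | apply exp_pos]. }
assert (Htail := fun N x y => PSeries_tail_le c N x y Hc HR).
assert (Hfc : forall x, 0 < x -> continuous (fun x => w x * PSeries c x) x).
{ intros x Hx; apply (continuous_mult (K := R_AbsRing)); [auto | now apply PSeries_continuous]. }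
assert (Hlim : is_lim_seq SN S) by now apply is_series_lim.
apply is_RInt_gen_pos_sup.
- exact Hfc.
- intros x Hx; apply Rmult_le_pos; [apply Rlt_le, Hw|].
  assert (H1 := proj1 (Htail 0%nat x x ltac:(lra) ltac:(lra))); assert (H2 := Hpcp 0%nat x Hx).
  unfold pc in H2; lra.
- intros u v Hu Huv.
  set (W := RInt w u v).
  (* On [[u, v]] the series is at most its partial sum plus the tail at [v]. The partial sum
     integrates to at most [SN N <= S], and the tail at [v] tends to 0 with [W] fixed. *)
  assert (B : forall N, RInt (fun x => w x * PSeries c x) u v <= S + (PSeries c v - pc N v) * W).
  { intros N.
    assert (E1 : ex_RInt (fun x => w x * pc N x) u v).
    { apply ex_RInt_pos; auto; intros x Hx; apply (continuous_mult (K := R_AbsRing)); auto. }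
    assert (E2 : ex_RInt w u v) by (apply ex_RInt_pos; auto).
    assert (E3 := is_RInt_plus _ _ _ _ _ _ (RInt_correct _ _ _ E1)
      (is_RInt_scal _ _ _ (PSeries c v - pc N v) _ (RInt_correct _ _ _ E2))).
    eapply Rle_trans; [apply (RInt_le _ _ u v Huv (ex_RInt_pos _ u v Hfc Hu Huv) (ex_intro _ _ E3))|].
    - intros x Hx; unfold scal, plus; simpl; unfold mult; simpl.
      destruct (Htail N x v ltac:(lra) ltac:(lra)) as [_ H].
      change (PSeries c x - pc N x <= PSeries c v - pc N v) in H.
      apply (Rmult_le_compat_l (w x)) in H; [|apply Rlt_le, Hw]; lra.
    - rewrite (is_RInt_unique (V := R_CompleteNormedModule) _ _ _ _ E3).
      unfold scal, plus; simpl; unfold mult; simpl.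
      apply Rplus_le_compat_r.
      apply Rle_trans with (2 := HSN N); now apply Hinv. }
  apply (is_lim_seq_le (fun _ => RInt (fun x => w x * PSeries c x) u v)
          (fun N => S + (PSeries c v - pc N v) * W)
          (RInt (fun x => w x * PSeries c x) u v) S B (is_lim_seq_const _)).
  replace (Finite S) with (Finite (S + (PSeries c v - PSeries c v) * W)) by (f_equal; ring).
  apply is_lim_seq_plus'; [apply is_lim_seq_const|].
  apply is_lim_seq_mult'; [|apply is_lim_seq_const].
  apply is_lim_seq_minus'; [apply is_lim_seq_const|].
  apply is_series_lim, Series_correct, ex_series_Rabs, CV_disk_inside; rewrite HR; exact I.
(* Half of [eps] pays for truncating the series at [N], the other half for restricting the integral
   of that partial sum to [[u, v]]. *)
- intros eps He.
  apply is_lim_seq_spec in Hlim.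
  destruct (Hlim (mkposreal (eps / 2) ltac:(lra))) as [N HN].
  specialize (HN N (Nat.le_refl N)); simpl in HN; apply Rabs_def2 in HN.
  destruct (proj2 (Hinv N) (eps / 2) ltac:(lra)) as [u [v [Hu [Huv H]]]].
  exists u, v; repeat split; auto.
  apply Rlt_le_trans with (RInt (fun x => w x * pc N x) u v); [lra|].
  apply RInt_le; auto.
  + apply ex_RInt_pos; auto; intros x Hx; apply (continuous_mult (K := R_AbsRing)); auto.
  + apply ex_RInt_pos; auto.
  + intros x Hx; apply Rmult_le_compat_l; [apply Rlt_le, Hw|].
    assert (H1 := proj1 (Htail N x x ltac:(lra) ltac:(lra))); unfold pc; lra.
Qed.

(** * The Marcum function *)

Lemma is_series_exp (z : R) : is_series (fun l => z ^ l / INR (fact l)) (exp z).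
Proof.
generalize (is_exp_Reals z); apply is_series_ext; intros n.
rewrite pow_n_pow; reflexivity.
Qed.

Lemma pow_div_fact_pos (z : R) (l : nat) : 0 <= z -> 0 <= z ^ l / INR (fact l).
Proof.
intros Hz; apply Rmult_le_pos; [now apply pow_le | apply Rlt_le, Rinv_0_lt_compat, INR_fact_lt_0].
Qed.

Lemma pow_div_fact_le_exp (z : R) (l : nat) : 0 <= z -> z ^ l / INR (fact l) <= exp z.
Proof.
intros Hz; apply Rle_trans with (sum_f_R0 (fun l => z ^ l / INR (fact l)) l).
- destruct l as [|l]; [apply Rle_refl|]; rewrite tech5.
  assert (0 <= sum_f_R0 (fun l => z ^ l / INR (fact l)) l)
    by (apply cond_pos_sum; intros; now apply pow_div_fact_pos); lra.
- apply sum_f_R0_le_series; [intros; now apply pow_div_fact_pos | apply is_series_exp].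
Qed.

(** For every [x >= 0] the terms are bounded by [M * exp (r * x)], so the radius is at least [x]. A
    finite radius [c] is refuted at [Rabs c + 1]. *)
Lemma CV_radius_div_fact (a : nat -> R) (M r : R) :
  0 <= M -> 0 <= r -> (forall j, Rabs (a j) <= M * r ^ j) ->
  CV_radius (fun j => a j / INR (fact j)) = p_infty.
Proof.
intros HM Hr Ha.
destruct (CV_radius_bounded (fun j => a j / INR (fact j))) as [Ub _].
assert (H : forall x : R, 0 <= x -> Rbar_le x (CV_radius (fun j => a j / INR (fact j)))).
{ intros x Hx; apply Ub; exists (M * exp (r * x)); intros n.
  replace (a n / INR (fact n) * x ^ n) with (a n * (x ^ n / INR (fact n)))
    by (field; apply INR_fact_neq_0).
  rewrite Rabs_mult, (Rabs_pos_eq (_ / _)) by now apply pow_div_fact_pos.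
  apply Rle_trans with (M * r ^ n * (x ^ n / INR (fact n))).
  - apply Rmult_le_compat_r; [now apply pow_div_fact_pos | apply Ha].
  - rewrite Rmult_assoc; apply Rmult_le_compat_l; [assumption|].
    unfold Rdiv; rewrite <- Rmult_assoc, <- Rpow_mult_distr.
    apply pow_div_fact_le_exp; now apply Rmult_le_pos. }
destruct (CV_radius (fun j => a j / INR (fact j))) as [c | |]; [| reflexivity |].
- assert (H1 := H (Rabs c + 1) ltac:(assert (Hc := Rabs_pos c); lra)); simpl in H1.
  assert (H2 := Rle_abs c); lra.
- exfalso; exact (H 0 (Rle_refl 0)).
Qed.

Definition exp_sum (z : R) (n : nat) : R := sum_f_R0 (fun l => z ^ l / INR (fact l)) n.

(** The [s_j] of the overview. The test is essential: for [j < m] the truncated [j - m] is 0, and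
    [exp_sum z 0] is 1 while the empty sum is 0. *)
Definition exp_sum_from (z : R) (m j : nat) : R :=
  if (j <? m)%nat then 0 else exp_sum z (j - m).

Lemma exp_sum_from_le_exp (z : R) (m j : nat) : 0 <= z -> 0 <= exp_sum_from z m j <= exp z.
Proof.
intros Hz; unfold exp_sum_from; destruct (Nat.ltb_spec j m).
- split; [lra | apply Rlt_le, exp_pos].
- split; [apply cond_pos_sum | apply sum_f_R0_le_series; [|apply is_series_exp]];
    intros l; now apply pow_div_fact_pos.
Qed.

Lemma exp_sum_from_incr (z : R) (m i j : nat) : 0 <= z -> (i <= j)%nat ->
  exp_sum_from z m i <= exp_sum_from z m j.
Proof.
intros Hz Hij; assert (H := exp_sum_from_le_exp z m j Hz); revert H; unfold exp_sum_from.
destruct (Nat.ltb_spec i m); [lra|].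
destruct (Nat.ltb_spec j m); [lia|].
intros _; apply sum_f_R0_le_sum; [intros; now apply pow_div_fact_pos | lia].
Qed.

Lemma exp_sum_from_approx (z : R) (m : nat) (eps : R) : 0 < eps ->
  exists N, exp z - eps < exp_sum_from z m N.
Proof.
intros He.
assert (H := proj1 (is_series_lim _ _) (is_series_exp z)).
apply is_lim_seq_spec in H; destruct (H (mkposreal eps He)) as [N HN].
specialize (HN N (Nat.le_refl N)); simpl in HN; apply Rabs_def2 in HN.
exists (N + m)%nat; unfold exp_sum_from, exp_sum.
destruct (Nat.ltb_spec (N + m) m); [lia|].
replace (N + m - m)%nat with N by lia; lra.
Qed.

(** Up to the factor [1 / j!], these differences are the coefficients of [P' - P], so each of them
    is a single term of the exponential series. *)
Lemma exp_sum_from_step (z : R) (n j : nat) :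
  exp_sum_from z (S n) (S j) - exp_sum_from z (S n) j =
  if (j <? n)%nat then 0 else z ^ (j - n) / INR (fact (j - n)).
Proof.
unfold exp_sum_from.
destruct (Nat.ltb_spec (S j) (S n)), (Nat.ltb_spec j (S n)), (Nat.ltb_spec j n); try lia; try ring.
(* Here [j = n]: the empty sum acquires its first term, 1. *)
- replace (j - n)%nat with 0%nat by lia; replace (S j - S n)%nat with 0%nat by lia.
  unfold exp_sum; simpl; ring.
- replace (S j - S n)%nat with (S (j - S n)) by lia; unfold exp_sum; rewrite tech5.
  replace (S (j - S n)) with (j - n)%nat by lia; ring.
Qed.

(* [exp (- z - y)] times the value at [y] of the power series with these coefficients is
   [1 - Q_m(sqrt (2 z), sqrt (2 y))]. *)
Definition coQ_coef (z : R) (m j : nat) : R := exp_sum_from z m j / INR (fact j).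

Lemma CV_radius_coQ (z : R) (m : nat) : 0 <= z -> CV_radius (coQ_coef z m) = p_infty.
Proof.
intros Hz; apply (CV_radius_div_fact _ (exp z) 1); [apply Rlt_le, exp_pos | lra|].
intros j; assert (H := exp_sum_from_le_exp z m j Hz).
rewrite pow1, Rmult_1_r, Rabs_pos_eq; lra.
Qed.

Lemma is_series_PSeries (c : nat -> R) (y : R) : CV_radius c = p_infty ->
  is_series (fun j => c j * y ^ j) (PSeries c y).
Proof.
intros HR; apply Series_correct, ex_series_Rabs, CV_disk_inside; rewrite HR; exact I.
Qed.

(** For [z > 0] and [y >= 0] this is [(y / z)^{n/2} I_n(2 sqrt (z y))]. The series form also covers
    [z = 0] and involves no roots. *)
Definition marcum_kernel (n : nat) (z y : R) : R :=
  Series (fun l => z ^ l / INR (fact l) * (y ^ (n + l) / INR (fact (n + l)))).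

Lemma marcum_kernel_PSeries (z : R) (n : nat) (y : R) : 0 <= z ->
  marcum_kernel n z y =
  PSeries (PS_derive (coQ_coef z (S n))) y - PSeries (coQ_coef z (S n)) y.
Proof.
intros Hz.
assert (HR := CV_radius_coQ z (S n) Hz).
assert (HR' : CV_radius (PS_derive (coQ_coef z (S n))) = p_infty) by now rewrite CV_radius_derive.
unfold PSeries; rewrite <- Series_minus;
  [|eexists; apply is_series_PSeries; assumption..].
assert (E : forall j, PS_derive (coQ_coef z (S n)) j * y ^ j - coQ_coef z (S n) j * y ^ j
  = (exp_sum_from z (S n) (S j) - exp_sum_from z (S n) j) * (y ^ j / INR (fact j))).
{ intros j; unfold PS_derive, coQ_coef; rewrite fact_simpl, mult_INR.
  field; split; [apply INR_fact_neq_0 | apply not_0_INR; lia]. }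
rewrite (Series_ext _ _ E); symmetry; rewrite (Series_incr_n_aux _ n).
- apply Series_ext; intros l; rewrite exp_sum_from_step.
  destruct (Nat.ltb_spec (n + l) n); [lia|].
  now replace (n + l - n)%nat with l by lia.
- intros j Hj; rewrite exp_sum_from_step.
  destruct (Nat.ltb_spec j n); [ring | lia].
Qed.

Lemma is_derive_coQ (z : R) (n : nat) (y : R) : 0 <= z ->
  is_derive (fun y => exp (- y) * PSeries (coQ_coef z (S n)) y) y (exp (- y) * marcum_kernel n z y).
Proof.
intros Hz; rewrite marcum_kernel_PSeries by assumption.
assert (HP : is_derive (PSeries (coQ_coef z (S n))) y (PSeries (PS_derive (coQ_coef z (S n))) y))
  by (apply is_derive_PSeries; rewrite CV_radius_coQ by assumption; exact I).
assert (He : is_derive (fun y => exp (- y)) y (- exp (- y))) by (auto_derive; [trivial | ring]).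
assert (H := is_derive_mult _ _ y _ _ He HP Rmult_comm).
set (P := PSeries (coQ_coef z (S n)) y) in *; set (P' := PSeries (PS_derive (coQ_coef z (S n))) y) in *.
replace (exp (- y) * (P' - P)) with (- exp (- y) * P + exp (- y) * P') by ring.
exact H.
Qed.

(* [exp_sum_from z m j >= exp_sum_from z m N * (1 - (N + 1) / (j + 1))] for every [j]. *)
Lemma coQ_bounds (z y : R) (m N : nat) : 0 <= z -> 0 < y ->
  exp_sum_from z m N * (1 - INR (S N) / y) <= exp (- y) * PSeries (coQ_coef z m) y <= exp z.
Proof.
intros Hz Hy.
assert (HP := is_series_PSeries (coQ_coef z m) y (CV_radius_coQ z m Hz)).
assert (Hs := exp_sum_from_le_exp z m).
assert (He := exp_pos y).
assert (Hpf : forall j, 0 <= y ^ j / INR (fact j)) by (intros; apply pow_div_fact_pos; lra).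
rewrite exp_Ropp; split.
- assert (H1 := is_series_exp y).
  assert (H2 : is_series (fun j => y ^ S j / INR (fact (S j))) (exp y - 1)).
  { apply (is_series_incr_1 (fun j => y ^ j / INR (fact j))).
    match goal with |- is_series _ ?l =>
      replace l with (exp y) by (unfold plus; simpl; field) end; exact H1. }
  (* Summing [y^j / j!] against the weight [1 / (j + 1)] gives [(e^y - 1) / y]; everything is
     multiplied by [y] so that both series are shifts of the exponential one. *)
  assert (H3 := is_series_scal (exp_sum_from z m N) _ _
    (is_series_minus _ _ _ _ (is_series_scal y _ _ H1) (is_series_scal (INR (S N)) _ _ H2))).
  assert (H4 := is_series_scal y _ _ HP).
  assert (H5 : (forall j, exp_sum_from z m N * (y * (y ^ j / INR (fact j)) +
                              - (INR (S N) * (y ^ S j / INR (fact (S j)))))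
                            <= y * (coQ_coef z m j * y ^ j)) ->
    exp_sum_from z m N * (y * exp y + - (INR (S N) * (exp y - 1))) <= y * PSeries (coQ_coef z m) y)
    by exact (fun H => is_series_le _ _ _ _ H H3 H4).
  apply (Rmult_le_reg_l (y * exp y)); [now apply Rmult_lt_0_compat|].
  replace (y * exp y * (/ exp y * PSeries (coQ_coef z m) y)) with (y * PSeries (coQ_coef z m) y)
    by (field; lra).
  apply Rle_trans with (exp_sum_from z m N * (y * exp y + - (INR (S N) * (exp y - 1)))).
  + replace (y * exp y * (exp_sum_from z m N * (1 - INR (S N) / y)))
      with (exp_sum_from z m N * (y * exp y - INR (S N) * exp y)) by (field; lra).
    apply Rmult_le_compat_l; [apply Hs, Hz | assert (H := pos_INR (S N)); lra].
  + apply H5; clear H5; intros j.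
    replace (y * (coQ_coef z m j * y ^ j)) with (exp_sum_from z m j * (y * (y ^ j / INR (fact j))))
      by (unfold coQ_coef; field; apply INR_fact_neq_0).
    replace (y ^ S j / INR (fact (S j))) with (/ INR (S j) * (y * (y ^ j / INR (fact j)))).
    2:{ rewrite fact_simpl, mult_INR; simpl pow; field;
        split; [apply INR_fact_neq_0 | apply not_0_INR; lia]. }
    replace (exp_sum_from z m N * (y * (y ^ j / INR (fact j)) +
       - (INR (S N) * (/ INR (S j) * (y * (y ^ j / INR (fact j)))))))
      with (exp_sum_from z m N * (1 - INR (S N) * / INR (S j)) * (y * (y ^ j / INR (fact j)))) by ring.
    apply Rmult_le_compat_r; [apply Rmult_le_pos; [lra | apply Hpf]|].
    assert (Hj : 0 < INR (S j)) by (apply lt_0_INR; lia).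
    assert (HN : 0 < INR (S N)) by (apply lt_0_INR; lia).
    assert (Hij : 0 < / INR (S j)) by now apply Rinv_0_lt_compat.
    assert (HsN := Hs N Hz).
    (* For [N <= j] monotonicity of [s_j] suffices. For [j < N] the factor [1 - (N + 1) / (j + 1)]
       is at most 0 while [s_j >= 0]. *)
    destruct (Nat.le_gt_cases N j) as [H | H].
    * assert (Hm := exp_sum_from_incr z m N j Hz H).
      assert (0 <= exp_sum_from z m N * (INR (S N) * / INR (S j)))
        by (apply Rmult_le_pos; [lra | apply Rmult_le_pos; lra]); lra.
    * assert (Hsj := Hs j Hz).
      assert (1 <= INR (S N) * / INR (S j)).
      { rewrite <- (Rinv_r (INR (S j))) by lra; apply Rmult_le_compat_r; [lra | apply le_INR; lia]. }
      assert (0 <= exp_sum_from z m N * (INR (S N) * / INR (S j) - 1)) by (apply Rmult_le_pos; lra).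
      lra.
- apply (Rmult_le_reg_l (exp y)); [assumption|].
  replace (exp y * (/ exp y * PSeries (coQ_coef z m) y)) with (PSeries (coQ_coef z m) y) by (field; lra).
  rewrite Rmult_comm.
  refine (is_series_le _ _ _ _ _ HP (is_series_scal (exp z) _ _ (is_series_exp y))).
  intros j; unfold scal; simpl; unfold mult; simpl.
  replace (coQ_coef z m j * y ^ j) with (exp_sum_from z m j * (y ^ j / INR (fact j)))
    by (unfold coQ_coef; field; apply INR_fact_neq_0).
  apply Rmult_le_compat_r; [apply Hpf | apply Hs, Hz].
Qed.

(** The Poisson weights [e^{-y} y^j / j!] move to large [j] as [y] grows, so the mean of [s_j]
    inherits its limit. In [coQ_bounds], [N] is fixed with [s_N > e^z - eps / 2], and then [y] is
    taken so large that the loss [e^z (N + 1) / y] is below [eps / 2]. *)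
Lemma coQ_filterlim_infty (z : R) (m : nat) : 0 <= z ->
  filterlim (fun y => exp (- y) * PSeries (coQ_coef z m) y) (Rbar_locally p_infty) (locally (exp z)).
Proof.
intros Hz; apply filterlim_locally; intros [eps He].
destruct (exp_sum_from_approx z m (eps / 2)) as [N HN]; [lra|].
assert (Hz' := exp_pos z); assert (HN' : 0 < INR (S N)) by (apply lt_0_INR; lia).
assert (HsN := exp_sum_from_le_exp z m N Hz).
exists (2 * exp z * INR (S N) / eps); intros y Hy.
assert (0 < 2 * exp z * INR (S N)) by (repeat apply Rmult_lt_0_compat; lra).
assert (Hy0 : 0 < y) by (eapply Rlt_trans; [|exact Hy]; now apply Rdiv_lt_0_compat).
destruct (coQ_bounds z y m N Hz Hy0) as [H1 H2].
assert (H3 : exp z * (INR (S N) / y) < eps / 2).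
{ apply (Rmult_lt_reg_r (2 * y / eps)); [apply Rdiv_lt_0_compat; lra|].
  replace (exp z * (INR (S N) / y) * (2 * y / eps)) with (2 * exp z * INR (S N) / eps) by (field; lra).
  replace (eps / 2 * (2 * y / eps)) with y by (field; lra); exact Hy. }
assert (H4 : exp_sum_from z m N * (INR (S N) / y) <= exp z * (INR (S N) / y)).
{ apply Rmult_le_compat_r; [apply Rlt_le, Rdiv_lt_0_compat|]; lra. }
unfold ball; simpl; unfold AbsRing_ball, abs, minus, plus, opp; simpl.
apply Rabs_def1; lra.
Qed.

Lemma marcum_kernel_continuous (n : nat) (z y : R) : 0 <= z -> continuous (marcum_kernel n z) y.
Proof.
intros Hz.
apply continuous_ext with (fun y => PSeries (PS_derive (coQ_coef z (S n))) y - PSeries (coQ_coef z (S n)) y).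
{ intros t; symmetry; now apply marcum_kernel_PSeries. }
apply (continuous_minus (V := R_NormedModule)); apply PSeries_continuous;
  rewrite ?CV_radius_derive; now apply CV_radius_coQ.
Qed.

(** The substitution [y = t^2 / 2] produces the factor [t] by the chain rule. The antiderivative is
    valid on the whole line, which is what admits a negative [be]. *)
Lemma is_RInt_gen_marcum_kernel (n : nat) (z be : R) : 0 <= z ->
  is_RInt_gen (fun t => t * exp (- (t ^ 2 / 2 + z)) * marcum_kernel n z (t ^ 2 / 2))
    (at_point be) (Rbar_locally p_infty)
    (1 - exp (- z) * (exp (- (be ^ 2 / 2)) * PSeries (coQ_coef z (S n)) (be ^ 2 / 2))).
Proof.
intros Hz.
set (G := fun y => exp (- y) * PSeries (coQ_coef z (S n)) y).
set (h := fun t => exp (- z) * G (t ^ 2 / 2)).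
set (dh := fun t => t * exp (- (t ^ 2 / 2 + z)) * marcum_kernel n z (t ^ 2 / 2)).
assert (Hq : forall t, is_derive (fun t => t ^ 2 / 2) t t)
  by (intros t; auto_derive; [trivial | field]).
assert (Hd : forall t, is_derive h t (dh t)).
{ intros t; unfold h, dh.
  assert (HG := is_derive_coQ z n (t ^ 2 / 2) Hz); fold G in HG.
  assert (H := is_derive_scal _ t (exp (- z)) _
                 (is_derive_comp G (fun t => t ^ 2 / 2) t _ _ HG (Hq t))).
  replace (t * exp (- (t ^ 2 / 2 + z)) * marcum_kernel n z (t ^ 2 / 2))
    with (exp (- z) * scal t (exp (- (t ^ 2 / 2)) * marcum_kernel n z (t ^ 2 / 2))); [exact H|].
  change (exp (- z) * (t * (exp (- (t ^ 2 / 2)) * marcum_kernel n z (t ^ 2 / 2)))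
    = t * exp (- (t ^ 2 / 2 + z)) * marcum_kernel n z (t ^ 2 / 2)).
  rewrite Ropp_plus_distr, exp_plus; ring. }
assert (Hdc : forall t, continuous dh t).
{ intros t; apply (continuous_mult (K := R_AbsRing)).
  - apply (ex_derive_continuous (V := R_NormedModule)); auto_derive; trivial.
  - apply (continuous_comp (fun t => t ^ 2 / 2) (marcum_kernel n z)).
    + apply (ex_derive_continuous (V := R_NormedModule)); eexists; apply Hq.
    + now apply marcum_kernel_continuous. }
apply (is_RInt_gen_ext (Derive h)).
{ apply filter_forall; intros ab t _; apply is_derive_unique, Hd. }
apply (is_RInt_gen_Derive h (h be) 1).
- apply filter_forall; intros ab t _; eexists; apply Hd.
- apply filter_forall; intros ab t _; apply continuous_ext with dh; [|apply Hdc].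
  intros s; symmetry; apply is_derive_unique, Hd.
- intros P HP; apply (locally_singleton _ _ HP).
- replace 1 with (exp (- z) * exp z) by (rewrite <- exp_plus, Rplus_opp_l; apply exp_0).
  apply (filterlim_comp _ _ _ (fun t => G (t ^ 2 / 2)) (fun g => exp (- z) * g) _ (locally (exp z))).
  + apply (filterlim_comp _ _ _ (fun t => t ^ 2 / 2) G _ (Rbar_locally p_infty)).
    (* For [t >= 2] one has [t^2 / 2 >= t], so exceeding [M] is inherited from [t]. *)
    * intros P [M HM]; exists (Rmax 2 M); intros t Ht; apply HM.
      assert (H1 := Rmax_l 2 M); assert (H2 := Rmax_r 2 M).
      assert (2 * t <= t ^ 2) by (simpl; rewrite Rmult_1_r; apply Rmult_le_compat_r; lra); lra.
    * now apply coQ_filterlim_infty.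
  + apply (filterlim_scal_r (K := R_AbsRing) (V := R_NormedModule) (exp (- z)) (exp z)).
Qed.

(** Both sides are [a^{n+2l} t^{2n+2l+1} / 2^{n+2l}]. As an identity of integer powers it holds for
    [a] and [t] of any sign. *)
Lemma pow_kernel_bessel (a t : R) (n l : nat) :
  a ^ n * t * ((a ^ 2 / 2) ^ l * (t ^ 2 / 2) ^ (n + l)) = t ^ S n * (a * t / 2) ^ (2 * l + n).
Proof.
unfold Rdiv.
replace (2 * l + n)%nat with (l + l + n)%nat by lia.
change (t ^ S n) with (t * t ^ n).
rewrite !pow_add, !Rpow_mult_distr, <- !pow_mult.
replace (2 * l)%nat with (l + l)%nat by lia; replace (2 * n)%nat with (n + n)%nat by lia.
rewrite !pow_add; ring.
Qed.

Lemma marcumQ_closed (n : nat) (a be : R) :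
  marcumQ (S n) a be =
  1 - exp (- (a ^ 2 / 2)) * (exp (- (be ^ 2 / 2)) * PSeries (coQ_coef (a ^ 2 / 2) (S n)) (be ^ 2 / 2)).
Proof.
assert (Hz : 0 <= a ^ 2 / 2) by (assert (H := pow2_ge_0 a); lra).
assert (HI := is_RInt_gen_marcum_kernel n (a ^ 2 / 2) be Hz).
unfold marcumQ; replace (S n - 1)%nat with n by lia; destruct (Req_EM_T a 0) as [-> | Ha].
- apply (is_RInt_gen_unique (V := R_CompleteNormedModule)).
  revert HI; apply is_RInt_gen_ext, filter_forall; intros ab t _.
  match goal with |- ?x = ?y => change (@eq R x y) end.
  replace (0 ^ 2 / 2) with 0 by (simpl; field).
  (* At [z = 0] only the term [l = 0] survives, because [0 ^ 0] is 1; this is the limiting integrand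
     in the definition of [marcumQ]. *)
  assert (K : marcum_kernel n 0 (t ^ 2 / 2) = (t ^ 2 / 2) ^ n / INR (fact n)).
  { apply is_series_unique, is_series_lim.
    apply is_lim_seq_ext with (fun _ => (t ^ 2 / 2) ^ n / INR (fact n)); [|apply is_lim_seq_const].
    intros N; induction N as [|N IH].
    - simpl; rewrite Nat.add_0_r; field; apply INR_fact_neq_0.
    - rewrite tech5, <- IH, pow_i by lia; unfold Rdiv; ring. }
  rewrite K, Rplus_0_r.
  replace (- (t ^ 2) / 2) with (- (t ^ 2 / 2)) by field.
  (* The instance reads [t (t^2 / 2)^n = t^{n+1} (t / 2)^n]. *)
  assert (E := pow_kernel_bessel 1 t n 0).
  rewrite pow1, Rmult_1_l, pow_O, Nat.add_0_r, !Rmult_1_l in E; simpl (2 * 0 + n)%nat in E.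
  unfold Rdiv in *; rewrite <- !Rmult_assoc.
  replace (t * exp (- (t ^ 2 * / 2)) * (t ^ 2 * / 2) ^ n)
    with (t * (t ^ 2 * / 2) ^ n * exp (- (t ^ 2 * / 2))) by ring.
  rewrite E; ring.
- assert (Han : a ^ n <> 0) by now apply pow_nonzero.
  apply (is_RInt_gen_scal _ (a ^ n)) in HI.
  rewrite (is_RInt_gen_unique (V := R_CompleteNormedModule) _
    (a ^ n * (1 - exp (- (a ^ 2 / 2)) *
      (exp (- (be ^ 2 / 2)) * PSeries (coQ_coef (a ^ 2 / 2) (S n)) (be ^ 2 / 2)))));
    [field; assumption|].
  revert HI; apply is_RInt_gen_ext, filter_forall; intros ab t _.
  change (a ^ n * (t * exp (- (t ^ 2 / 2 + a ^ 2 / 2)) * marcum_kernel n (a ^ 2 / 2) (t ^ 2 / 2))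
    = t ^ S n * exp (- (t ^ 2 + a ^ 2) / 2) * besselI n (a * t)).
  replace (- (t ^ 2 + a ^ 2) / 2) with (- (t ^ 2 / 2 + a ^ 2 / 2)) by field.
  replace (a ^ n * (t * exp (- (t ^ 2 / 2 + a ^ 2 / 2)) * marcum_kernel n (a ^ 2 / 2) (t ^ 2 / 2)))
    with (exp (- (t ^ 2 / 2 + a ^ 2 / 2)) * (a ^ n * t * marcum_kernel n (a ^ 2 / 2) (t ^ 2 / 2))) by ring.
  replace (t ^ S n * exp (- (t ^ 2 / 2 + a ^ 2 / 2)) * besselI n (a * t))
    with (exp (- (t ^ 2 / 2 + a ^ 2 / 2)) * (t ^ S n * besselI n (a * t))) by ring.
  f_equal; unfold marcum_kernel, besselI; rewrite <- !Series_scal_l.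
  apply Series_ext; intros l.
  replace (l + n)%nat with (n + l)%nat by lia.
  assert (F1 := INR_fact_neq_0 l); assert (F2 := INR_fact_neq_0 (n + l)).
  transitivity (a ^ n * t * ((a ^ 2 / 2) ^ l * (t ^ 2 / 2) ^ (n + l)) / (INR (fact l) * INR (fact (n + l)))).
  + field; split; assumption.
  + rewrite pow_kernel_bessel; field; split; assumption.
Qed.

(** * The Humbert series and the theorem *)

Lemma poch_pos (k : R) (n : nat) : 0 < k -> 0 < poch k n.
Proof. intros Hk; apply Rdiv_lt_0_compat; [now apply Gamma_add_pos | now apply Gamma_pos]. Qed.

Lemma poch_succ (k : R) (n : nat) : 0 < k -> poch k (S n) = (k + INR n) * poch k n.
Proof.
intros Hk; unfold poch; rewrite S_INR, <- Rplus_assoc, Gamma_succ by (assert (H := pos_INR n); lra).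
unfold Rdiv; ring.
Qed.

(** The terms of the binomial series of [(1 - x)^{-k}], called [d_j] in the overview. *)
Definition binom_coef (k x : R) (j : nat) : R := poch k j / INR (fact j) * x ^ j.

Lemma binom_coef_nonneg (k x : R) (j : nat) : 0 < k -> 0 <= x -> 0 <= binom_coef k x j.
Proof.
intros Hk Hx; apply Rmult_le_pos; [|now apply pow_le].
apply Rlt_le, Rdiv_lt_0_compat; [now apply poch_pos | apply INR_fact_lt_0].
Qed.

Lemma ex_series_binom (k x : R) : 0 < k -> 0 <= x < 1 -> ex_series (binom_coef k x).
Proof.
intros Hk Hx.
(* D'Alembert's test needs nonzero terms, hence the comparison with a positive argument. *)
pose (x' := (1 + x) / 2).
assert (Hx' : 0 < x' < 1) by (unfold x'; lra).
assert (Hp : forall n, 0 < binom_coef k x' n).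
{ intros n; apply Rmult_lt_0_compat; [|apply pow_lt; lra].
  apply Rdiv_lt_0_compat; [now apply poch_pos | apply INR_fact_lt_0]. }
apply (ex_series_le (K := R_AbsRing) (V := R_CompleteNormedModule) _ (fun n => Rabs (binom_coef k x' n))).
- intros n; unfold norm; simpl; unfold abs; simpl.
  rewrite !Rabs_pos_eq by (apply binom_coef_nonneg; lra).
  apply Rmult_le_compat_l; [|apply pow_incr; unfold x'; lra].
  apply Rlt_le, Rdiv_lt_0_compat; [now apply poch_pos | apply INR_fact_lt_0].
- apply (ex_series_DAlembert _ x'); [lra | intros n; apply Rgt_not_eq, Hp|].
  apply is_lim_seq_ext with (fun n => x' * (1 + (k - 1) * / INR (S n))).
  + intros n; rewrite Rabs_pos_eq by (apply Rlt_le, Rdiv_lt_0_compat; apply Hp).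
    unfold binom_coef; rewrite poch_succ, fact_simpl, mult_INR by assumption; simpl pow.
    assert (H1 := INR_fact_neq_0 n).
    assert (H2 : INR (S n) <> 0) by (apply not_0_INR; lia).
    assert (H3 : x' ^ n <> 0) by (apply pow_nonzero; lra).
    assert (H4 := poch_pos k n Hk).
    replace (k + INR n) with (INR (S n) + (k - 1)) by (rewrite S_INR; ring).
    field; repeat split; try assumption; lra.
  + replace (Finite x') with (Finite (x' * (1 + (k - 1) * 0))) by (f_equal; ring).
    apply is_lim_seq_mult'; [apply is_lim_seq_const|].
    apply is_lim_seq_plus'; [apply is_lim_seq_const|].
    apply is_lim_seq_mult'; [apply is_lim_seq_const|].
    apply (is_lim_seq_incr_1 (fun n => / INR n)).
    apply (is_lim_seq_inv _ p_infty); [apply is_lim_seq_INR | easy].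
Qed.

(* The [n]-th row of the Humbert series [Phi_1(k, 1, 1; x, z x)]. *)
Definition humbert_row (k x z : R) (n : nat) : R :=
  Series (fun l => binom_coef k x (n + l) * (z ^ l / INR (fact l))).

(** On the antidiagonal [n + l = j] the coefficient [d_{m+j}] is constant and the [z^l / l!] add up
    to [exp_sum z j]; domination by [e^z d_{m+j}] gives convergence. The offset [m] lets the same
    fact evaluate the tail and, at [m = 0], justify splitting off the first rows. *)
Lemma is_series_humbert_rows (k x z : R) (m : nat) : 0 < k -> 0 <= x < 1 -> 0 <= z ->
  is_series (fun n => humbert_row k x z (m + n))
    (Series (fun j => binom_coef k x (m + j) * exp_sum z j)).
Proof.
intros Hk Hx Hz.
pose (u := fun n l => binom_coef k x (m + n + l) * (z ^ l / INR (fact l))).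
refine (proj2 (series_antidiagonal u _ _ _)).
- intros n l; apply Rmult_le_pos; [apply binom_coef_nonneg; lra | now apply pow_div_fact_pos].
- apply is_series_ext with (fun j => binom_coef k x (m + j) * exp_sum z j).
  + intros j; unfold exp_sum; rewrite scal_sum; apply sum_eq; intros l Hl; unfold u.
    replace (m + (j - l) + l)%nat with (m + j)%nat by lia; ring.
  + apply Series_correct.
    apply (ex_series_le (K := R_AbsRing) (V := R_CompleteNormedModule) _
      (fun j => binom_coef k x (m + j) * exp z)).
    * intros j; unfold norm; simpl; unfold abs; simpl.
      assert (H := binom_coef_nonneg k x (m + j) Hk (proj1 Hx)).
      assert (H1 : 0 <= exp_sum z j) by (apply cond_pos_sum; intros; now apply pow_div_fact_pos).
      rewrite Rabs_pos_eq by now apply Rmult_le_pos.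
      apply Rmult_le_compat_l; [assumption|].
      apply sum_f_R0_le_series; [intros; now apply pow_div_fact_pos | apply is_series_exp].
    * apply ex_series_scal_r.
      apply (ex_series_incr_n (binom_coef k x) m), ex_series_binom; assumption.
Qed.

(** Because [(1)_n = n!], the middle parameter cancels [1 / n!] and the lower one becomes
    [(n + l)!]. The second argument [z x] makes the powers combine to [x^{n+l}]. *)
Lemma humbertPhi1_rows (k x z : R) : humbertPhi1 k 1 1 x (z * x) = Series (humbert_row k x z).
Proof.
unfold humbertPhi1, humbert_row; apply Series_ext; intros n; apply Series_ext; intros l.
rewrite !poch_1; unfold binom_coef; rewrite Rpow_mult_distr, pow_add.
field; repeat split; apply INR_fact_neq_0.
Qed.

(** Rests on [(k)_n (k + n)_l = (k)_{n+l}] and [n! (n + 1)_l = (n + l)!]. *)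
Lemma hyp1F1_row (k x z : R) (n : nat) : 0 < k ->
  poch k n / INR (fact n) * x ^ n * hyp1F1 (k + INR n) (INR n + 1) (z * x) = humbert_row k x z n.
Proof.
intros Hk; unfold hyp1F1, humbert_row; rewrite <- Series_scal_l; apply Series_ext; intros l.
unfold binom_coef; rewrite <- poch_add, poch_INR, Rpow_mult_distr, pow_add by assumption.
field; repeat split; apply INR_fact_neq_0.
Qed.

Lemma humbertPhi1_minus_rows (k x z : R) (n : nat) : 0 < k -> 0 <= x < 1 -> 0 <= z ->
  humbertPhi1 k 1 1 x (z * x)
  - sum_f_R0 (fun i => poch k i / INR (fact i) * x ^ i * hyp1F1 (k + INR i) (INR i + 1) (z * x)) n
  = Series (fun j => binom_coef k x (S n + j) * exp_sum z j).
Proof.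
intros Hk Hx Hz.
rewrite humbertPhi1_rows, (Series_incr_n _ (S n)); [|lia|].
- rewrite (is_series_unique _ _ (is_series_humbert_rows k x z (S n) Hk Hx Hz)).
  simpl Nat.pred; rewrite (sum_eq (humbert_row k x z)
    (fun i => poch k i / INR (fact i) * x ^ i * hyp1F1 (k + INR i) (INR i + 1) (z * x)) n); [ring|].
  intros i _; symmetry; now apply hyp1F1_row.
- eexists; apply (is_series_humbert_rows k x z 0 Hk Hx Hz).
Qed.

Lemma sqr_frac_bounds (b p : R) : 0 < p -> 0 <= b ^ 2 / (b ^ 2 + 2 * p) < 1.
Proof.
intros Hp; assert (Hb := pow2_ge_0 b).
split; [apply Rmult_le_pos; [lra | apply Rlt_le, Rinv_0_lt_compat; lra]|].
apply (Rmult_lt_reg_r (b ^ 2 + 2 * p)); [lra|].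
unfold Rdiv; rewrite Rmult_assoc, Rinv_l by lra; lra.
Qed.

Lemma is_RInt_gen_coQ (k p b z : R) (m : nat) : 0 < k -> 0 < p -> 0 <= z ->
  is_RInt_gen (fun x => Rpower x (k - 1) * exp (- ((p + b ^ 2 / 2) * x))
                        * PSeries (coQ_coef z m) (b ^ 2 / 2 * x))
    (at_right 0) (Rbar_locally p_infty)
    (Gamma k * Rpower (2 / (b ^ 2 + 2 * p)) k
     * Series (fun j => binom_coef k (b ^ 2 / (b ^ 2 + 2 * p)) (m + j) * exp_sum z j)).
Proof.
intros Hk Hp Hz.
assert (Hb := pow2_ge_0 b).
set (q := p + b ^ 2 / 2); set (r := b ^ 2 / 2); set (x0 := b ^ 2 / (b ^ 2 + 2 * p)).
assert (Hq : 0 < q) by (unfold q; lra).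
assert (Hr : 0 <= r) by (unfold r; lra).
assert (Hx0 : 0 <= x0 < 1) by now apply sqr_frac_bounds.
assert (Hqr : r / q = x0) by (unfold r, q, x0; field; lra).
pose (c := fun j => exp_sum_from z m j * r ^ j / INR (fact j)).
assert (Hs := exp_sum_from_le_exp z m).
apply (is_RInt_gen_pos_ext (fun x => Rpower x (k - 1) * exp (- (q * x)) * PSeries c x)).
{ intros x _; f_equal; apply Series_ext; intros j; unfold c, coQ_coef.
  rewrite Rpow_mult_distr; field; apply INR_fact_neq_0. }
apply is_RInt_gen_Gamma_PSeries; auto.
- intros j; apply Rmult_le_pos; [apply Rmult_le_pos; [apply Hs, Hz | now apply pow_le]|].
  apply Rlt_le, Rinv_0_lt_compat, INR_fact_lt_0.
- apply (CV_radius_div_fact _ (exp z) r); [apply Rlt_le, exp_pos | assumption|].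
  intros j; rewrite Rabs_pos_eq by (apply Rmult_le_pos; [apply Hs, Hz | now apply pow_le]).
  apply Rmult_le_compat_r; [now apply pow_le | apply Hs, Hz].
(* Since [r / q = x0], the quotient [r^j / q^{k+j}] is [q^{-k} x0^j], and [q^{-k}] is the prefactor
   [(2 / (b^2 + 2 p))^k]. *)
- apply is_series_ext with
    (fun j => scal (Gamma k * Rpower (2 / (b ^ 2 + 2 * p)) k) (binom_coef k x0 j * exp_sum_from z m j)).
  { intros j.
    change (Gamma k * Rpower (2 / (b ^ 2 + 2 * p)) k * (binom_coef k x0 j * exp_sum_from z m j)
      = c j * (Gamma (k + INR j) / Rpower q (k + INR j))).
    replace (2 / (b ^ 2 + 2 * p)) with (/ q) by (unfold q; field; lra).
    rewrite Rpower_plus, Rpower_pow by assumption.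
    assert (Rpower (/ q) k = / Rpower q k) as ->.
    { unfold Rpower; rewrite ln_Rinv by assumption.
      rewrite <- exp_Ropp; f_equal; ring. }
    unfold binom_coef, c, poch; rewrite <- Hqr; unfold Rdiv; rewrite Rpow_mult_distr, pow_inv.
    assert (G := Gamma_pos k Hk); assert (0 < Rpower q k) by apply exp_pos.
    assert (q ^ j <> 0) by (apply pow_nonzero; lra).
    field; repeat split; try apply INR_fact_neq_0; try assumption; lra. }
  apply (is_series_scal (K := R_AbsRing) (V := R_NormedModule)).
  replace (Series (fun j => binom_coef k x0 (m + j) * exp_sum z j))
    with (Series (fun j => binom_coef k x0 j * exp_sum_from z m j)).
  + apply Series_correct.
    apply (ex_series_le (K := R_AbsRing) (V := R_CompleteNormedModule) _
      (fun j => binom_coef k x0 j * exp z)).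
    * intros j; unfold norm; simpl; unfold abs; simpl.
      assert (H := binom_coef_nonneg k x0 j Hk (proj1 Hx0)); assert (H1 := Hs j Hz).
      rewrite Rabs_pos_eq by (apply Rmult_le_pos; lra).
      apply Rmult_le_compat_l; lra.
    * now apply ex_series_scal_r, ex_series_binom.
  (* The cutoff in [exp_sum_from] kills the terms with [j < m], so the index may be shifted by
     [m]. *)
  + rewrite (Series_incr_n_aux _ m).
    * apply Series_ext; intros j; unfold exp_sum_from.
      destruct (Nat.ltb_spec (m + j) m); [lia|].
      now replace (m + j - m)%nat with j by lia.
    * intros j Hj; unfold exp_sum_from; destruct (Nat.ltb_spec j m); [ring | lia].
Qed.

Theorem theorem1 (a b : R) (m : nat) (k p : R)
  (Hm : (1 <= m)%nat) (Hk : 0 < k) (Hp : 0 < p) :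
  calG k m a b p =
  Gamma k / Rpower p k
  - Rpower (2 / (b ^ 2 + 2 * p)) k * exp (- (a ^ 2) / 2) * Gamma k *
    (humbertPhi1 k 1 1 (b ^ 2 / (b ^ 2 + 2 * p)) (a ^ 2 * b ^ 2 / (2 * b ^ 2 + 4 * p))
     - sum_f_R0 (fun n => poch k n / INR (Factorial.fact n) * (b ^ 2 / (b ^ 2 + 2 * p)) ^ n
                  * hyp1F1 (k + INR n) (INR n + 1) (a ^ 2 * b ^ 2 / (2 * b ^ 2 + 4 * p)))
                (m - 1)).
Proof.
(* The upper bound of [sum_f_R0] is inclusive: with [m = S n] the sum up to [n] has exactly [m]
   terms. *)
destruct m as [|n]; [lia|]; replace (S n - 1)%nat with n by lia.
assert (Hb := pow2_ge_0 b).
assert (Hz : 0 <= a ^ 2 / 2) by (assert (H := pow2_ge_0 a); lra).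
assert (Hx := sqr_frac_bounds b p Hp).
(* The second Humbert argument is [z] times the first, with [z = a^2 / 2]. *)
replace (a ^ 2 * b ^ 2 / (2 * b ^ 2 + 4 * p)) with (a ^ 2 / 2 * (b ^ 2 / (b ^ 2 + 2 * p)))
  by (field; lra).
rewrite humbertPhi1_minus_rows by assumption.
replace (- (a ^ 2) / 2) with (- (a ^ 2 / 2)) by field.
unfold calG; apply (is_RInt_gen_unique (V := R_CompleteNormedModule)).
assert (I := is_RInt_gen_minus _ _ _ _ (is_Gamma_scaled k p Hk Hp)
  (is_RInt_gen_scal _ (exp (- (a ^ 2 / 2))) _ (is_RInt_gen_coQ k p b (a ^ 2 / 2) (S n) Hk Hp Hz))).
set (T := Series _) in *.
replace (Gamma k / Rpower p k - Rpower (2 / (b ^ 2 + 2 * p)) k * exp (- (a ^ 2 / 2)) * Gamma k * T)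
  with (Gamma k / Rpower p k - exp (- (a ^ 2 / 2)) * (Gamma k * Rpower (2 / (b ^ 2 + 2 * p)) k * T))
  by ring.
refine (is_RInt_gen_pos_ext _ _ _ _ I).
intros x Hx0; rewrite marcumQ_closed, Rpow_mult_distr.
replace (sqrt x ^ 2) with x by (simpl; rewrite Rmult_1_r, sqrt_sqrt; lra).
replace (b ^ 2 * x / 2) with (b ^ 2 / 2 * x) by field.
replace (- ((p + b ^ 2 / 2) * x)) with (- (p * x) + - (b ^ 2 / 2 * x)) by ring.
rewrite exp_plus.
unfold minus, plus, opp, scal; simpl; unfold mult; simpl; ring.
Qed.
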